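(* Let $\boldsymbol{\pi}\in\mathbb{R}^n$ be a vector with positive entries such that $\boldsymbol{\pi}^T\mathbf{1}=1$. The map $\hat{R}: \mathcal{T}\mathbb{S}_n^{\boldsymbol{\pi}} \to \mathbb{S}_n^{\boldsymbol{\pi}}$ whose restriction $\hat{R}_{S}$ to $\mathcal{T}_S\mathbb{S}_n^{\boldsymbol{\pi}}$ is given by $$\hat{R}_{S}(\xi_S) = \mathcal{S}\left( S \odot \exp(\xi_S \oslash S )\right)$$ is a first-order retraction on $\mathbb{S}_n^{\boldsymbol{\pi}}$, where $\exp(\cdot)$ is the entrywise exponential and $\mathcal{S}(\cdot)$ maps a positive matrix to its diagonal scaling belonging to $\mathbb{S}_n^{\boldsymbol{\pi}}$.
   Context: $\mathbf{1}=(1,\ldots,1)^T\in\mathbb{R}^n$; $\odot$ and $\oslash$ denote entrywise (Hadamard) multiplication and division; $S>0$ means all entries are positive. $\mathbb{S}_n^{\boldsymbol{\pi}} = \{ S \in \mathbb{R}^{n \times n} : S \mathbf{1} = \mathbf{1},\ \boldsymbol{\pi}^T S = \boldsymbol{\pi}^T,\ S > 0 \}$ is an embedded submanifold of $\mathbb{R}^{n\times n}$ whose tangent space at $S$ is $\mathcal{T}_S \mathbb{S}_n^{\boldsymbol{\pi}} = \{ \xi \in \mathbb{R}^{n \times n} : \xi \mathbf{1} = \mathbf{0},\ \boldsymbol{\pi}^T \xi = \mathbf{0}^T \}$, and $\mathcal{T}\mathbb{S}_n^{\boldsymbol{\pi}}$ is the tangent bundle. For a matrix $A\in\mathbb{R}^{n\times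 n}$ with positive entries, $\mathcal{S}(A)=D_1AD_2$, the output of the modified Sinkhorn-Knopp algorithm, where $D_1,D_2$ are diagonal matrices with positive diagonal entries such that $D_1AD_2\mathbf{1}=\mathbf{1}$ and $\boldsymbol{\pi}^TD_1AD_2=\boldsymbol{\pi}^T$; such $D_1,D_2$ exist and are unique up to replacing $(D_1,D_2)$ by $(cD_1,c^{-1}D_2)$ with $c>0$, so $\mathcal{S}(A)$ is well defined. A (first-order) retraction on a manifold $\mathcal{M}$ is a smooth map $R$ from the tangent bundle $\mathcal{T}\mathcal{M}$ to $\mathcal{M}$ such that, for every $x\in\mathcal{M}$, the restriction $R_x$ of $R$ to $\mathcal{T}_x\mathcal{M}$ satisfies: (centering) $R_x(0)=x$; (local rigidity) for every $\xi_x\in\mathcal{T}_x\mathcal{M}$, the curve $\gamma_{\xi_x}(\tau)=R_x(\tau\xi_x)$ satisfies $\frac{d\gamma_{\xi_x}(\tau)}{d\tau}\big|_{\tau=0}=\xi_x$. *)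

(* Defs.v *)
From mathcomp Require Import all_boot all_order all_algebra.
From mathcomp Require Import all_classical all_reals all_analysis.

Set Implicit Arguments.
Unset Strict Implicit.
Unset Printing Implicit Defensive.

Import Order.TTheory GRing.Theory Num.Theory.
Import numFieldNormedType.Exports.

Local Open Scope classical_set_scope.
Local Open Scope ring_scope.

(** ** Smooth maps and retractions on subsets of a normed space *)

(* [Ck k U f] is meant for [U] open and finite-dimensional [V], where pointwise
   continuity of [x |-> 'd f x v] for every [v] is the same as continuity of
   [x |-> 'd f x] in operator norm, so that this is the usual class C^k. *)
Fixpoint Ck (R : realType) (V W : normedModType R) (k : nat) (U : set V)
    (f : V -> W) : Prop :=
  match k with
  | 0%N => forall x, U x -> {for x, continuous f}
  | k'.+1 => (forall x, U x -> differentiable f x) /\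
             (forall v : V, Ck k' U (fun x => 'd f x v))
  end.

Definition Cinfty (R : realType) (V W : normedModType R) (U : set V)
    (f : V -> W) : Prop :=
  forall k : nat, Ck k U f.

(* Smoothness on an embedded submanifold [M] of [V]: near each point of [M],
   [f] is the restriction of a C^oo map on an open subset of [V].  The values
   of [f] outside [M] are irrelevant. *)
Definition smooth_on (R : realType) (V W : normedModType R) (M : set V)
    (f : V -> W) : Prop :=
  forall x, M x -> exists (U : set V) (F : V -> W),
    [/\ open U, U x, Cinfty U F & forall y, M y -> U y -> F y = f y].

Definition tangent_bundle (R : realType) (V : normedModType R) (M : set V)
    (T : V -> set V) : set (V * V) :=
  [set p | M p.1 /\ T p.1 p.2].

(* [M] is an embedded submanifold of [V] with tangent space [T x] at [x], and
   [Rt (x, xi)] is the value R_x(xi) of the retraction. *)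
Record first_order_retraction (R : realType) (V : normedModType R) (M : set V)
    (T : V -> set V) (Rt : V * V -> V) : Prop := {
  retraction_maps : forall p, tangent_bundle M T p -> M (Rt p);
  retraction_smooth : smooth_on (tangent_bundle M T) Rt;
  retraction_centering : forall x, M x -> Rt (x, 0) = x;
  retraction_rigidity : forall x xi, M x -> T x xi ->
    is_derive (0 : R) 1 (fun t : R => Rt (x, t *: xi)) xi
}.

(** ** The manifold of positive matrices with fixed marginals *)

Section Multinomial.
Variables (R : realType) (n : nat).
Implicit Types (p : 'cV[R]_n) (A B S xi : 'M[R]_n).

Definition ones : 'cV[R]_n := const_mx 1.

Definition stoch_manifold p : set 'M[R]_n :=
  [set S | [/\ S *m ones = ones, p^T *m S = p^T & forall i j, 0 < S i j]].

Definition stoch_tangent p (S : 'M[R]_n) : set 'M[R]_n :=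
  [set xi | xi *m ones = 0 /\ p^T *m xi = 0].

Definition is_scaling p A B : Prop :=
  exists d1 d2 : 'rV[R]_n,
    [/\ forall i, 0 < d1 0 i, forall i, 0 < d2 0 i,
        B = diag_mx d1 *m A *m diag_mx d2,
        B *m ones = ones & p^T *m B = p^T].

(* "The" diagonal scaling of [A]; the default value [0] is taken only when [A]
   has no scaling, and is never an element of [stoch_manifold p] for [0 < n]. *)
Definition sinkhorn p A : 'M[R]_n := xget 0 [set B | is_scaling p A B].

Definition hadamard_mul A B : 'M[R]_n := \matrix_(i, j) (A i j * B i j).
Definition hadamard_div A B : 'M[R]_n := \matrix_(i, j) (A i j / B i j).

Definition sinkhorn_retraction p (q : 'M[R]_n * 'M[R]_n) : 'M[R]_n :=
  let S := q.1 in let xi := q.2 in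
  sinkhorn p (hadamard_mul S (map_mx (@expR R) (hadamard_div xi S))).

End Multinomial.
Arguments ones {R n}.

(* Main.v *)
From HB Require Import structures.
Require Import Defs.
From mathcomp Require Import all_boot all_order all_algebra.
From mathcomp Require Import all_classical all_reals all_analysis.
From mathcomp Require Import ring lra.
Import Order.TTheory GRing.Theory Num.Theory.
Import numFieldNormedType.Exports.
Local Open Scope classical_set_scope.
Local Open Scope ring_scope.
Set Implicit Arguments.
Unset Strict Implicit.
Unset Printing Implicit Defensive.

(** Taking logarithms, the theorem reduces to the study of the map [log_sinkhorn]
    that sends an arbitrary matrix [L] to the scaling [S] of its entrywise
    exponential: a matrix [S] of the manifold is this scaling exactly when [ln S - L]
    (entrywise) is additive, of the form [a i + b j].  The retraction at [(S, xi)] is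
    the value of [log_sinkhorn] at [ln S + xi / S], and this argument is plainly
    smooth where [S] is positive.

    Existence of the scaling is obtained by minimizing the convex dual potential in
    the logarithms of the column factors ([scaling_potential_min],
    [scaling_potential_critical]).

    Uniqueness and regularity rest on one fact.  The difference of two scalings has
    zero marginals, hence is orthogonal to additive matrices for the inner product
    weighted by [p]; since the logarithm expands distances on the interval from 0 to
    1, the map [log_sinkhorn] does not expand the weighted norm
    ([log_scales_contract]).  In particular it is well defined and Lipschitz.

    Differentiating the equation, the derivative [X] of [S] in the direction [M] has
    zero marginals and [X / S - M] is additive.  This linear system is uniquely
    solvable, because the inner product of [X] and [X / S] is a positive definite
    quadratic form ([linearized_inj0]).  The Lipschitz bound turns the formal
    derivative into a true one ([log_sinkhorn_is_diff]), without an implicit function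
    theorem.  The derivative is a rational expression in [S] and [M] by Cramer's
    formula, so an induction on the order of differentiability gives smoothness
    ([Ck_log_sinkhorn]).

    Finally [ln S] is sent to [S], which is centering; and for tangent [xi] the
    system in the direction [xi / S] is solved by [xi] itself, which is local
    rigidity. *)

(** * Calculus of functions of class C^k *)

Section Differentiability.
Variable R : realType.
Implicit Types V W : normedModType R.

(** Differentiability from the epsilon form of the first-order expansion, for a
    bundled linear candidate [df]. *)
Lemma is_diff_epsP V W (f : V -> W) (df : {linear V -> W}) (x : V) :
  continuous df ->
  (forall e : R, 0 < e ->
     \forall h \near (0 : V), `|f (h + x) - (f x + df h)| <= e * `|h|) ->
  is_diff x f df.
Proof.
move=> dfc dfe.
have dfo : f \o shift x = cst (f x) + df +o_ 0 id.
  by apply/eqaddoP => e e0; near=> h; rewrite /=; near: h; exact: dfe.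
have dE := diff_unique dfc dfo.
by apply: DiffDef => //; apply/diff_locallyP; rewrite dE.
Unshelve. all: by end_near. Qed.

Lemma near_eq_is_diff V W (f g df : V -> W) (x : V) :
  (\forall y \near x, f y = g y) -> is_diff x f df -> is_diff x g df.
Proof.
move=> fg fx.
have dfx : differentiable f x by [].
suff : is_diff x g ('d f x) by rewrite diff_val.
apply: is_diff_epsP => [|e e0]; first exact: diff_continuous.
have : \forall h \near 0, f (h + x) = g (h + x).
  by have := fg; rewrite (near_shift 0 x) /=; apply: filterS => h; rewrite /= subr0.
have /eqaddoP /(_ e e0) := diff_locally dfx.
rewrite /= => fo fgh; near=> h.
rewrite -(nbhs_singleton fg) -(near fgh h)//.
by near: h.
Unshelve. all: by end_near. Qed.

End Differentiability.

Section CkCalculus.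
Variables (R : realType) (V : normedModType R) (U : set V).
Hypothesis U_open : open U.
Implicit Types W : normedModType R.

Let U_near x : U x -> \forall y \near x, U y.
Proof. by move=> Ux; apply: open_nbhs_nbhs. Qed.

(** Being of class C^k on an open set depends only on the values on that set:
    near each of its points the two functions, hence their differentials, agree. *)
Lemma Ck_ext W k (f g : V -> W) :
  (forall x, U x -> f x = g x) -> Ck k U f -> Ck k U g.
Proof.
elim: k f g => [|k IHk] f g fg /=.
  move=> fc x Ux; rewrite /prop_for /continuous_at -(fg x Ux).
  apply: cvg_trans (fc x Ux); apply: near_eq_cvg.
  by apply: filterS (U_near Ux) => y /fg.
have fgd x : U x -> differentiable f x -> is_diff x g ('d f x).
  move=> Ux df; apply: near_eq_is_diff (differentiableP df).
  by apply: filterS (U_near Ux) => y /fg.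
move=> [df ddf]; split=> [x Ux|v]; first by have := fgd x Ux (df x Ux).
apply: IHk (ddf v) => x Ux.
by have dg := fgd x Ux (df x Ux); rewrite [in RHS]diff_val.
Qed.

(** The form in which the induction on [k] is run below: it suffices to exhibit
    any expression [df] of the differential on [U] that is of class C^k. *)
Lemma CkS W k (f : V -> W) (df : V -> V -> W) :
  (forall x, U x -> is_diff x f (df x)) ->
  (forall v, Ck k U (fun x => df x v)) -> Ck k.+1 U f.
Proof.
move=> dfP dfk; split=> [x /dfP //|v].
by apply: Ck_ext (dfk v) => x /dfP dfx; rewrite [in RHS]diff_val.
Qed.

Lemma CkS_is_diff W k (f : V -> W) x :
  Ck k.+1 U f -> U x -> is_diff x f ('d f x).
Proof. by move=> [df _] Ux; apply/differentiableP/df. Qed.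

(** A function of class C^(k+1) is of class C^k. *)
Lemma CkW W k (f : V -> W) : Ck k.+1 U f -> Ck k U f.
Proof.
elim: k f => [|k IHk] f [df ddf].
  by move=> x Ux; apply/differentiable_continuous/df.
by split=> // v; apply: IHk; apply: ddf.
Qed.

Lemma Ck_cst W k (a : W) : Ck k U (fun=> a).
Proof.
elim: k a => [|k IHk] a; first by move=> x _; exact: cvg_cst.
by apply: (CkS (df := fun _ _ => 0)) => // x _; exact: is_diff_cst.
Qed.

Lemma Ck_id k : Ck k U (@id V).
Proof.
case: k => [|k]; first by move=> x _; exact: cvg_id.
by apply: (CkS (df := fun _ v => v)) => v; exact: Ck_cst.
Qed.

Lemma Ck_linear W W' k (g : {linear W -> W'}) (f : V -> W) :
  continuous g -> Ck k U f -> Ck k U (fun x => g (f x)).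
Proof.
move=> gc; elim: k f => [|k IHk] f fk.
  by move=> x Ux; apply: continuous_comp; [exact: fk|exact: gc].
apply: (CkS (df := fun x v => g ('d f x v))) => [x Ux|v]; last first.
  by apply: IHk; have [_] := fk; apply.
have fx := CkS_is_diff fk Ux.
have gx : is_diff (f x) g g.
  by apply: DiffDef; [exact: linear_differentiable|exact: diff_lin].
exact: is_diff_comp.
Qed.

Lemma CkD W k (f g : V -> W) :
  Ck k U f -> Ck k U g -> Ck k U (fun x => f x + g x).
Proof.
elim: k f g => [|k IHk] f g fk gk.
  by move=> x Ux; apply: cvgD; [exact: fk|exact: gk].
apply: (CkS (df := fun x v => 'd f x v + 'd g x v)) => [x Ux|v].
  by have fx := CkS_is_diff fk Ux; have gx := CkS_is_diff gk Ux;
     exact: is_diffD.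
by apply: IHk; [have [_] := fk; apply|have [_] := gk; apply].
Qed.

Lemma CkM k (f g : V -> R) :
  Ck k U f -> Ck k U g -> Ck k U (fun x => f x * g x).
Proof.
elim: k f g => [|k IHk] f g fk gk.
  by move=> x Ux; apply: cvgM; [exact: fk|exact: gk].
apply: (CkS (df := fun x v => f x * 'd g x v + g x * 'd f x v)) => [x Ux|v].
  by have fx := CkS_is_diff fk Ux; have gx := CkS_is_diff gk Ux;
     exact: is_diffM.
apply: CkD.
  by apply: IHk; [exact: CkW|have [_] := gk; apply].
by apply: IHk; [exact: CkW|have [_] := fk; apply].
Qed.

Lemma CkN k (f : V -> R) : Ck k U f -> Ck k U (fun x => - f x).
Proof.
move=> fk; apply: (@Ck_ext _ _ (fun x => -1 * f x)) => [x _|].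
  by rewrite mulN1r.
by apply: CkM => //; exact: Ck_cst.
Qed.

Lemma Ck_sum W k (I : Type) (r : seq I) (P : pred I) (f : I -> V -> W) :
  (forall i, P i -> Ck k U (f i)) -> Ck k U (fun x => \sum_(i <- r | P i) f i x).
Proof.
move=> fk; elim: r => [|i r IHr].
  by apply: (Ck_ext _ (Ck_cst k 0)) => x _; rewrite big_nil.
have [Pi|Pi] := boolP (P i).
  by apply: (Ck_ext _ (CkD (fk i Pi) IHr)) => x _; rewrite big_cons Pi.
by apply: (Ck_ext _ IHr) => x _; rewrite big_cons (negbTE Pi).
Qed.

Lemma Ck_prod k (I : Type) (r : seq I) (P : pred I) (f : I -> V -> R) :
  (forall i, P i -> Ck k U (f i)) -> Ck k U (fun x => \prod_(i <- r | P i) f i x).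
Proof.
move=> fk; elim: r => [|i r IHr].
  by apply: (Ck_ext _ (Ck_cst k (1 : R))) => x _; rewrite big_nil.
have [Pi|Pi] := boolP (P i).
  by apply: (Ck_ext _ (CkM (fk i Pi) IHr)) => x _; rewrite big_cons Pi.
by apply: (Ck_ext _ IHr) => x _; rewrite big_cons (negbTE Pi).
Qed.

Lemma CkV k (f : V -> R) :
  (forall x, U x -> f x != 0) -> Ck k U f -> Ck k U (fun x => (f x)^-1).
Proof.
move=> f0; elim: k => [|k IHk] fk.
  by move=> x Ux; apply: cvgV; [exact: f0|exact: fk].
apply: (CkS (df := fun x v => - ((f x)^-1 * (f x)^-1) * 'd f x v)) => [x Ux|v].
  have fx := CkS_is_diff fk Ux; apply: DiffDef.
    by apply: differentiableV => //; exact: f0.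
  rewrite diffV//; last exact: f0.
  by apply/funext => v /=; rewrite -exprVn expr2.
apply: CkM; last by have [_] := fk; apply.
by apply: CkN; apply: CkM; apply: IHk; exact: CkW.
Qed.

Lemma Ck_ln k (f : V -> R) :
  (forall x, U x -> 0 < f x) -> Ck k U f -> Ck k U (fun x => ln (f x)).
Proof.
move=> f0; case: k => [|k] fk.
  move=> x Ux; apply: continuous_comp; first exact: fk.
  exact/continuous_ln/f0.
apply: (CkS (df := fun x v => 'd f x v * (f x)^-1)) => [x Ux|v].
  have fx := CkS_is_diff fk Ux.
  have lnf := is_derive1_ln (f0 x Ux).
  have lnd : is_diff (f x) (@ln R) (fun h => h *: (f x)^-1).
    have dl : differentiable (@ln R) (f x) by apply/derivable1_diffP.
    by apply: DiffDef => //; rewrite diff1E// derive1E derive_val.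
  exact: is_diff_comp.
apply: CkM; first by have [_] := fk; apply.
by apply: CkV; [move=> x /f0 /lt0r_neq0|exact: CkW].
Qed.

Lemma Ck_mx k m n (f : V -> 'M[R]_(m, n)) :
  (forall i j, Ck k U (fun x => f x i j)) -> Ck k U f.
Proof.
move=> fk; apply: (@Ck_ext _ _ (fun x => \sum_i \sum_j f x i j *: delta_mx i j)).
  by move=> x _; rewrite -matrix_sum_delta.
apply: Ck_sum => i _; apply: Ck_sum => j _.
have lg : linear ( *:%R ^~ (delta_mx i j) : R -> 'M[R]_(m, n)).
  by move=> a u v; rewrite scalerDl scalerA.
pose g : {linear R -> 'M[R]_(m, n)} :=
  HB.pack ( *:%R ^~ (delta_mx i j)) (GRing.isLinear.Build _ _ _ _ _ lg).
apply: (Ck_linear (g := g)) (fk i j).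
exact: scalel_continuous.
Qed.

Lemma Ck_coord k m n (f : V -> 'M[R]_(m, n)) i j :
  Ck k U f -> Ck k U (fun x => f x i j).
Proof.
have lc : linear (fun M : 'M[R]_(m, n) => M i j).
  by move=> a M N; rewrite !mxE.
pose g : {linear 'M[R]_(m, n) -> R} :=
  HB.pack (fun M : 'M[R]_(m, n) => M i j)
    (GRing.isLinear.Build _ _ _ _ _ lc).
by apply: (Ck_linear (g := g)); exact: coord_continuous.
Qed.

Lemma Ck_mulmx k m n q (f : V -> 'M[R]_(m, n)) (g : V -> 'M[R]_(n, q)) :
  Ck k U f -> Ck k U g -> Ck k U (fun x => f x *m g x).
Proof.
move=> fk gk; apply: Ck_mx => i j.
apply: (@Ck_ext _ _ (fun x => \sum_l f x i l * g x l j)).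
  by move=> x _; rewrite mxE.
by apply: Ck_sum => l _; apply: CkM; exact: Ck_coord.
Qed.

Lemma Ck_det k n (f : V -> 'M[R]_n) :
  Ck k U f -> Ck k U (fun x => \det (f x)).
Proof.
move=> fk; apply: Ck_sum => s _; apply: CkM; first exact: Ck_cst.
by apply: Ck_prod => i _; exact: Ck_coord.
Qed.

(** By Cramer's formula the entries of the inverse are polynomials in the entries
    divided by the determinant. *)
Lemma Ck_invmx k n (f : V -> 'M[R]_n) :
  (forall x, U x -> f x \in unitmx) -> Ck k U f -> Ck k U (fun x => invmx (f x)).
Proof.
move=> fu fk; apply: Ck_mx => i j.
apply: (@Ck_ext _ _ (fun x => (\det (f x))^-1 * cofactor (f x) j i)).
  by move=> x Ux; rewrite /invmx fu// !mxE.
apply: CkM.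
  apply: CkV; last exact: Ck_det.
  by move=> x /fu; rewrite unitmxE unitfE.
apply: CkM; first exact: Ck_cst.
apply: Ck_det; apply: Ck_mx => i' j'.
apply: (@Ck_ext _ _ (fun x => f x (lift j i') (lift i j'))).
  by move=> x _; rewrite !mxE.
exact: Ck_coord.
Qed.

End CkCalculus.

Lemma linear_mx_continuous (R : realType) (W : normedModType R) (m n : nat)
    (f : {linear 'M[R]_(m, n) -> W}) :
  continuous f.
Proof.
move=> M; rewrite (_ : (f : _ -> _) =
    (fun N => \sum_i \sum_j N i j *: f (delta_mx i j))); last first.
  apply/funext => N; rewrite {1}[N]matrix_sum_delta linear_sum.
  apply: eq_bigr => i _; rewrite linear_sum; apply: eq_bigr => j _.
  exact: linearZ.
apply: (Ck_sum openT (k := 0)) => // i _; apply: (Ck_sum openT (k := 0)) => j _.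
move=> N _; exact: (continuous_comp (@coord_continuous R m n i j N)
  (@scalel_continuous R W (f (delta_mx i j)) (N i j))).
Qed.

Lemma mx_norm_le (R : realType) (m n : nat) (c : R) (M : 'M[R]_(m, n)) :
  0 <= c -> (forall i j, `|M i j| <= c) -> `|M| <= c.
Proof.
move=> c0 Mc; rewrite [`|M|]mx_normrE; apply: bigmax_le => // ij _; exact: Mc.
Qed.

Lemma coord_le_norm (R : realType) (m n : nat) (M : 'M[R]_(m, n)) i j :
  `|M i j| <= `|M|.
Proof.
rewrite [`|M|]mx_normrE; exact: (le_bigmax _ (fun ij => `|M ij.1 ij.2|) (i, j)).
Qed.

(** * Existence of the scaling *)

Section Existence.
Variables (R : realType) (n : nat) (p : 'cV[R]_n).
Hypothesis p_gt0 : forall i, 0 < p i 0.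
Hypothesis p_sum1 : \sum_i p i 0 = 1.

(** Row sums and [p]-weighted column sums, the two families of marginals. *)
Lemma mulmx_onesP (m : nat) (X : 'M[R]_(m, n)) i :
  (X *m ones) i 0 = \sum_j X i j.
Proof. by rewrite mxE; apply: eq_bigr => j _; rewrite mxE mulr1. Qed.

Lemma tr_mulmxE (X : 'M[R]_n) j :
  (p^T *m X) 0 j = \sum_i p i 0 * X i j.
Proof. by rewrite mxE; apply: eq_bigr => i _; rewrite mxE. Qed.

Variable A : 'M[R]_n.
Hypothesis A_gt0 : forall i j, 0 < A i j.

(** The row sums of [A] after scaling its columns by [expR (v 0 j)]. *)
Definition row_weight (v : 'rV[R]_n) i := \sum_j A i j * expR (v 0 j).

(** The dual potential of the scaling problem, with the column scaling in
    logarithmic form and the row scaling eliminated: it makes every row sum equal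
    to 1.  Its critical points are the column scalings that give the weighted
    column sums [p]. *)
Definition scaling_potential (v : 'rV[R]_n) : R :=
  \sum_i p i 0 * ln (row_weight v i) - \sum_j p j 0 * v 0 j.

Let term_gt0 (v : 'rV[R]_n) i j : 0 < A i j * expR (v 0 j).
Proof. by rewrite mulr_gt0// expR_gt0. Qed.

Lemma le_row_weight (v : 'rV[R]_n) i j : A i j * expR (v 0 j) <= row_weight v i.
Proof.
by rewrite /row_weight (bigD1 j)//= lerDl sumr_ge0// => k _; exact: ltW.
Qed.

Lemma row_weight_gt0 v i : 0 < row_weight v i.
Proof. exact: lt_le_trans (term_gt0 v i i) (le_row_weight v i i). Qed.

Lemma scaling_potential_continuous : continuous scaling_potential.
Proof.
suff Ck0 : Ck 0 setT scaling_potential by move=> v; exact: Ck0.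
have vC j : Ck 0 setT (fun v : 'rV[R]_n => v 0 j).
  by move=> v _; exact: coord_continuous.
apply: CkD => //; first exact: openT.
  apply: Ck_sum => [|i _]; first exact: openT.
  apply: CkM; [exact: openT|exact: (Ck_cst openT)|].
  apply: Ck_ln; [exact: openT|by move=> v _; exact: row_weight_gt0|].
  apply: Ck_sum => [|j _]; first exact: openT.
  apply: CkM; [exact: openT|exact: (Ck_cst openT)|].
  by move=> v _; apply: continuous_comp; [exact: vC|exact: continuous_expR].
apply: CkN; first exact: openT.
apply: Ck_sum => [|j _]; first exact: openT.
by apply: CkM; [exact: openT|exact: (Ck_cst openT)|exact: vC].
Qed.

(** Multiplying all column factors by a constant is absorbed by the row factors. *)
Lemma scaling_potential_shift v c :
  scaling_potential (v + const_mx c) = scaling_potential v.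
Proof.
have rwE i : row_weight (v + const_mx c) i = expR c * row_weight v i.
  rewrite /row_weight mulr_sumr; apply: eq_bigr => j _.
  by rewrite !mxE expRD mulrA mulrC.
rewrite /scaling_potential.
under eq_bigr do rewrite rwE lnM ?posrE ?expR_gt0 ?row_weight_gt0// expRK mulrDr.
under [X in _ - X]eq_bigr do rewrite !mxE mulrDr.
by rewrite !big_split/= -!mulr_suml p_sum1; ring.
Qed.

(** A crude constant with [- entry_bound <= ln (A i j)] for all entries. *)
Definition entry_bound : R := \sum_i \sum_j `|ln (A i j)|.

(** Coercivity modulo shifts: on the hyperplane of vectors of [p]-mean zero the
    potential bounds every coordinate from above, hence also from below because the
    weighted mean is zero. *)
Lemma le_scaling_potential (v : 'rV[R]_n) k : \sum_j p j 0 * v 0 j = 0 ->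
  v 0 k <= scaling_potential v + entry_bound.
Proof.
move=> v0; rewrite /scaling_potential v0 subr0.
have Pb i j : `|ln (A i j)| <= entry_bound.
  rewrite /entry_bound (bigD1 i)//= (bigD1 j)//= -addrA lerDl.
  by rewrite addr_ge0//; repeat (apply: sumr_ge0 => ? _ //).
rewrite -lerBlDr -[leLHS]mul1r -p_sum1 mulr_suml.
apply: ler_sum => i _; rewrite ler_pM2l//.
have -> : v 0 k - entry_bound = ln (expR (v 0 k)) - entry_bound by rewrite expRK.
rewrite lerBlDr (@le_trans _ _ (ln (A i k * expR (v 0 k)) + entry_bound))//.
  rewrite lnM ?posrE ?expR_gt0// addrAC lerDr -lerBlDl sub0r.
  by apply: le_trans (Pb i k); rewrite -normrN ler_norm.
by rewrite lerD2r ler_ln ?posrE// ?row_weight_gt0// le_row_weight.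
Qed.

(** The minimum over a large box is global: any vector can be shifted to have
    [p]-mean zero, and then it lies in the box unless its potential exceeds the one
    at 0. *)
Lemma scaling_potential_min :
  exists v, forall w, scaling_potential v <= scaling_potential w.
Proof.
(* [c] bounds the coordinates of a vector of mean zero from above, and [c / p j 0]
   bounds the opposite of its [j]-th coordinate, on the sublevel set of 0. *)
pose c := `|scaling_potential 0| + entry_bound.
have eb0 : 0 <= entry_bound.
  by rewrite /entry_bound; repeat (apply: sumr_ge0 => ? _ //).
have c0 : 0 <= c by rewrite addr_ge0.
pose M := c + \sum_j c / p j 0.
have sM0 : 0 <= \sum_j c / p j 0.
  by apply: sumr_ge0 => j _; rewrite divr_ge0// ltW.
pose K : set 'rV[R]_n := [set v | forall i, `[- M, M]%classic (v 0 i)].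
have Kc : compact K.
  apply: (@rV_compact _ _ (fun=> `[- M, M]%classic)) => i; exact: segment_compact.
have K0 : K 0.
  by move=> i; rewrite /= in_itv/= mxE oppr_le0 /M addr_ge0.
have [v vK vmin] : exists2 v, v \in K &
    forall w, w \in K -> scaling_potential v <= scaling_potential w.
  apply: EVT_min_rV => //; first by exists 0.
  exact/continuous_subspaceT/scaling_potential_continuous.
exists v => w.
pose w' := w + const_mx (- \sum_j p j 0 * w 0 j).
have w'0 : \sum_j p j 0 * w' 0 j = 0.
  under eq_bigr do rewrite !mxE mulrDr.
  by rewrite big_split/= -mulr_suml p_sum1 mul1r subrr.
rewrite -(scaling_potential_shift w (- \sum_j p j 0 * w 0 j)) -/w'.
have [w'le|/ltW w'ge] := leP (scaling_potential w') (scaling_potential 0);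
  last first.
  by apply: le_trans w'ge; apply: vmin; rewrite inE.
apply: vmin; rewrite inE => k /=; rewrite in_itv/=.
have wc j : w' 0 j <= c.
  apply: le_trans (le_scaling_potential j w'0) _.
  by rewrite lerD2r (le_trans w'le)// ler_norm.
apply/andP; split; last by rewrite (le_trans (wc k))// lerDl.
rewrite lerNl (@le_trans _ _ (c / p k 0))//; last first.
  rewrite /M (bigD1 k)//= addrCA lerDl addr_ge0// sumr_ge0// => j _.
  by rewrite divr_ge0// ltW.
rewrite ler_pdivlMr// mulNr lerNl mulrC.
move: w'0; rewrite (bigD1 k)//= => /eqP; rewrite addr_eq0 => /eqP ->.
rewrite lerN2 (@le_trans _ _ (\sum_(i | i != k) p i 0 * c))//.
  by apply: ler_sum => i _; rewrite ler_pM2l.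
rewrite -mulr_suml ler_piMl// -p_sum1 [leRHS](bigD1 k)//= lerDr.
exact: ltW.
Qed.

(** The first-order condition at a minimizer, in coordinate [k].  The bound
    [ln (1 + x) <= x] replaces differentiation: moving the [k]-th coordinate by [t]
    changes the potential by at most [s * (expR t - 1) - p k 0 * t], where [s] is the
    weighted sum of column [k]. *)
Lemma scaling_potential_critical v :
  (forall w, scaling_potential v <= scaling_potential w) ->
  forall k, \sum_i p i 0 * ((row_weight v i)^-1 * A i k * expR (v 0 k)) = p k 0.
Proof.
move=> vmin k; set s := LHS.
have s_gt0 : 0 < s.
  rewrite /s (bigD1 k)//= ltr_pwDl//.
    by rewrite !mulr_gt0 ?invr_gt0 ?row_weight_gt0// expR_gt0.
  apply: sumr_ge0 => i _; apply: ltW.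
  by rewrite !mulr_gt0 ?invr_gt0 ?row_weight_gt0// expR_gt0.
have key t : p k 0 * t <= s * (expR t - 1).
  have := vmin (v + t *: delta_mx 0 k).
  set w := v + _.
  have wE j : w 0 j = v 0 j + t *+ (j == k).
    by rewrite !mxE eqxx/=; case: (j == k); rewrite ?mulr1 ?mulr0.
  have rwE i : row_weight w i = row_weight v i + A i k * expR (v 0 k) * (expR t - 1).
    rewrite /row_weight (bigD1 k)//= [in RHS](bigD1 k)//= wE eqxx mulr1n expRD.
    rewrite mulrBr mulr1 addrAC mulrA [X in _ = X + _]addrC subrK; congr (_ + _).
    by apply: eq_bigr => j /negbTE jk; rewrite wE jk addr0.
  have sumE : \sum_j p j 0 * w 0 j = \sum_j p j 0 * v 0 j + p k 0 * t.
    under eq_bigr do rewrite wE mulrDr.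
    rewrite big_split/=; congr (_ + _).
    rewrite (bigD1 k)//= eqxx big1 ?addr0// => j /negbTE ->.
    by rewrite mulr0.
  have lnE i : ln (row_weight w i) <= ln (row_weight v i) +
      (row_weight v i)^-1 * A i k * expR (v 0 k) * (expR t - 1).
    have v0 := row_weight_gt0 v i.
    rewrite -lerBlDl -ln_div ?posrE ?row_weight_gt0//.
    have wvE : row_weight w i / row_weight v i =
        1 + (row_weight v i)^-1 * A i k * expR (v 0 k) * (expR t - 1).
      by rewrite rwE mulrDl divff ?gt_eqF// [X in _ = _ + X]mulrC; ring.
    rewrite wvE; apply: le_ln1Dx.
    by rewrite -subr_gt0 opprK addrC -wvE divr_gt0// row_weight_gt0.
  have sumle : \sum_i p i 0 * ln (row_weight w i) <=
      \sum_i p i 0 * ln (row_weight v i) + s * (expR t - 1).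
    rewrite /s mulr_suml -big_split/=; apply: ler_sum => i _.
    by rewrite -mulrA -mulrDr ler_pM2l.
  rewrite /scaling_potential sumE; lra.
(* The gap in [key] is smallest where its derivative in [t] vanishes; at that [t] the
   bound contradicts the strict inequality [1 - t < expR (- t)] unless [t] is 0. *)
have pk0 := p_gt0 k.
pose t := ln (p k 0 / s).
have et : expR t = p k 0 / s by rewrite lnK// posrE divr_gt0.
have t0 : t = 0.
  apply/eqP/negPn/negP => tN0.
  have Nt0 : - t != 0 by rewrite oppr_eq0.
  have := expR_gt1Dx Nt0; rewrite expRN et invf_div => stp.
  have := key t; rewrite et mulrBr mulr1 (mulrC s) divfK ?gt_eqF//.
  by move: stp; rewrite ltr_pdivlMr// mulrBl mul1r (mulrC t); lra.
by move: et; rewrite t0 expR0 => /esym/divr1_eq ->.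
Qed.

Lemma scaling_exists : exists B, is_scaling p A B.
Proof.
have [v /scaling_potential_critical vcrit] := scaling_potential_min.
pose d1 : 'rV[R]_n := \row_i (row_weight v i)^-1.
pose d2 : 'rV[R]_n := \row_j expR (v 0 j).
pose B := diag_mx d1 *m A *m diag_mx d2.
have BE i j : B i j = (row_weight v i)^-1 * A i j * expR (v 0 j).
  by rewrite /B mul_mx_diag mxE mul_diag_mx !mxE.
exists B, d1, d2; split=> //.
- by move=> i; rewrite mxE invr_gt0 row_weight_gt0.
- by move=> i; rewrite mxE expR_gt0.
- apply/colP => i; rewrite mulmx_onesP mxE.
  under eq_bigr do rewrite BE -mulrA.
  by rewrite -mulr_sumr mulVf// gt_eqF// row_weight_gt0.
- apply/rowP => j; rewrite tr_mulmxE mxE -(vcrit j).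
  by apply: eq_bigr => i _; rewrite BE.
Qed.

End Existence.

(** * Lipschitz dependence of the scaling on the logarithm of the matrix *)

Section Scaling.
Variables (R : realType) (n : nat) (p : 'cV[R]_n).
Hypothesis p_gt0 : forall i, 0 < p i 0.
Hypothesis p_sum1 : p^T *m ones = 1%:M.
Implicit Types A B L S X Y M : 'M[R]_n.

Lemma weights_sum1 : \sum_i p i 0 = 1.
Proof.
have p1 : (p^T *m ones) 0 0 = 1 by rewrite p_sum1 mxE.
by rewrite -p1 mxE; apply: eq_bigr => i _; rewrite !mxE mulr1.
Qed.

(** The matrix with entries [a i 0 + b 0 j]; on logarithms, the effect of a diagonal
    scaling. *)
Definition additive_mx (a : 'cV[R]_n) (b : 'rV[R]_n) : 'M[R]_n :=
  a *m ones^T + ones *m b.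

Lemma additive_mxE a b i j : additive_mx a b i j = a i 0 + b 0 j.
Proof. by rewrite !mxE !big_ord1 !mxE mulr1 mul1r. Qed.

Lemma additive_mxD a b a' b' :
  additive_mx a b + additive_mx a' b' = additive_mx (a + a') (b + b').
Proof. by apply/matrixP => i j; rewrite mxE !additive_mxE !mxE; ring. Qed.

Lemma additive_mxN a b : - additive_mx a b = additive_mx (- a) (- b).
Proof. by apply/matrixP => i j; rewrite mxE !additive_mxE !mxE; ring. Qed.

(** The inner product of matrices in which row [i] has weight [p i 0]. *)
Definition weighted_dot X Y : R := \sum_i \sum_j p i 0 * (X i j * Y i j).

Lemma weighted_dotDr X Y Y' :
  weighted_dot X (Y + Y') = weighted_dot X Y + weighted_dot X Y'.
Proof.
rewrite /weighted_dot -big_split/=; apply: eq_bigr => i _.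
by rewrite -big_split/=; apply: eq_bigr => j _; rewrite !mxE; ring.
Qed.

Lemma le_weighted_dot X Y X' Y' :
  (forall i j, X i j * Y i j <= X' i j * Y' i j) ->
  weighted_dot X Y <= weighted_dot X' Y'.
Proof.
move=> le; apply: ler_sum => i _; apply: ler_sum => j _.
by rewrite ler_pM2l.
Qed.

Lemma weighted_dot_eq0 X Y : (forall i j, 0 <= X i j * Y i j) ->
  weighted_dot X Y <= 0 -> forall i j, X i j * Y i j = 0.
Proof.
move=> ge0 le0 i j.
have ge0' k l : 0 <= p k 0 * (X k l * Y k l) by rewrite mulr_ge0// ltW.
move: le0; rewrite /weighted_dot (bigD1 i)//= (bigD1 j)//= => le0.
have : p i 0 * (X i j * Y i j) <= 0.
  apply: le_trans le0; rewrite -addrA lerDl addr_ge0//.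
    by apply: sumr_ge0 => l _.
  by apply: sumr_ge0 => k _; apply: sumr_ge0 => l _.
rewrite pmulr_rle0// => le0'.
by apply/eqP; rewrite eq_le le0' ge0.
Qed.

(** The tangent space (which does not depend on the base point [S]) is orthogonal to
    the additive matrices. *)
Lemma tangent_additive_orthogonal S X a b :
  stoch_tangent p S X -> weighted_dot X (additive_mx a b) = 0.
Proof.
move=> [X1 pX]; rewrite /weighted_dot.
under eq_bigr do under eq_bigr do rewrite additive_mxE mulrDr mulrDr.
under eq_bigr do rewrite big_split/=.
rewrite big_split/= [X in _ + X]exchange_big/=.
rewrite big1 ?add0r => [|i _]; last first.
  rewrite -mulr_sumr -mulr_suml -mulmx_onesP X1.
  by rewrite !mxE mul0r mulr0.
rewrite big1// => j _; under eq_bigr do rewrite mulrA.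
by rewrite -mulr_suml -tr_mulmxE pX mxE mul0r.
Qed.

Lemma stoch_manifold_le1 S i j : stoch_manifold p S -> S i j <= 1.
Proof.
move=> [S1 _ S0]; have -> : 1 = \sum_j S i j.
  by rewrite -mulmx_onesP S1 mxE.
by rewrite (bigD1 j)//= lerDl sumr_ge0// => k _; exact: ltW.
Qed.

Lemma stoch_manifold_sub S S' : stoch_manifold p S -> stoch_manifold p S' ->
  stoch_tangent p S (S' - S).
Proof.
by move=> [S1 pS _] [S'1 pS' _]; split;
   rewrite ?mulmxBl ?mulmxBr ?S1 ?S'1 ?pS ?pS' subrr.
Qed.

(** [S] is the scaling with the prescribed marginals of the entrywise exponential of
    [L].  Working with logarithms makes the parameter space the full matrix space. *)
Definition log_scales L S :=
  stoch_manifold p S /\ exists a b, map_mx (@ln R) S = L + additive_mx a b.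

(** The logarithm expands distances on the interval from 0 to 1. *)
Lemma sqr_le_ln (s t : R) : 0 < s <= 1 -> 0 < t <= 1 ->
  (t - s) ^+ 2 <= (t - s) * (ln t - ln s).
Proof.
wlog st : s t / s <= t.
  move=> H s01 t01; have [|/ltW] := leP s t; first by move=> /H; apply.
  by move=> /H /(_ t01 s01); rewrite -[s - t]opprB -[ln s - _]opprB sqrrN mulrNN.
move=> /andP[s0 s1] /andP[t0 t1].
rewrite expr2; apply: ler_wpM2l; first by rewrite subr_ge0.
have : ln (1 + (s / t - 1)) <= s / t - 1.
  by apply: le_ln1Dx; rewrite ltrBrDl subrr divr_gt0.
rewrite addrC subrK ln_div ?posrE//.
have : t - s <= (t - s) / t by rewrite ler_pdivlMr// ler_piMr// subr_ge0.
rewrite mulrBl divff ?gt_eqF//; lra.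
Qed.

(** The scaling does not expand the weighted norm, as a function of the logarithm of
    the matrix.  Indeed [S' - S] is tangent, hence orthogonal to the additive part of
    the difference of the logarithms of [S'] and [S], so that its inner product with
    this difference is its inner product with [L' - L]; the former dominates the
    square of the norm of [S' - S] by [sqr_le_ln]. *)
Lemma log_scales_contract L L' S S' : log_scales L S -> log_scales L' S' ->
  weighted_dot (S' - S) (S' - S) <= weighted_dot (L' - L) (L' - L).
Proof.
move=> [mS [a [b lnS]]] [mS' [a' [b' lnS']]].
have lnB : map_mx (@ln R) S' - map_mx (@ln R) S =
    (L' - L) + additive_mx (a' - a) (b' - b).
  by rewrite lnS lnS' opprD addrACA additive_mxN additive_mxD.
have le1 : weighted_dot (S' - S) (S' - S) <= weighted_dot (S' - S) (L' - L).
  rewrite -[leRHS]addr0.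
  have TS := stoch_manifold_sub mS mS'.
  rewrite -(tangent_additive_orthogonal (a' - a) (b' - b) TS).
  rewrite -weighted_dotDr -lnB; apply: le_weighted_dot => i j.
  rewrite !mxE -expr2; apply: sqr_le_ln; rewrite stoch_manifold_le1//.
    by case: mS => _ _ ->.
  by case: mS' => _ _ ->.
have le2 : weighted_dot (S' - S) (L' - L) *+ 2 <=
    weighted_dot (S' - S) (S' - S) + weighted_dot (L' - L) (L' - L).
  rewrite /weighted_dot -big_split/= -sumrMnl; apply: ler_sum => i _.
  rewrite -big_split/= -sumrMnl; apply: ler_sum => j _.
  rewrite -mulrDr -mulrnAr ler_pM2l// -subr_ge0.
  set x := (S' - S) i j; set y := (L' - L) i j.
  by rewrite (_ : _ - _ = (x - y) ^+ 2) ?sqr_ge0//; ring.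
by move: le1 le2; rewrite mulr2n; lra.
Qed.

Lemma log_scales_unique L S S' : log_scales L S -> log_scales L S' -> S = S'.
Proof.
move=> LS LS'; have := log_scales_contract LS LS'.
have -> : weighted_dot (L - L) (L - L) = 0.
  by rewrite subrr; do 2!(apply: big1 => ? _); rewrite mxE mul0r mulr0.
move=> /weighted_dot_eq0 eq0; apply/esym/subr0_eq/matrixP => i j.
have /eqP : (S' - S) i j * (S' - S) i j = 0.
  by apply: eq0 => k l; rewrite -expr2 sqr_ge0.
by rewrite mulf_eq0 orbb => /eqP ->; rewrite mxE.
Qed.

Lemma is_scaling_log_scales A B : (forall i j, 0 < A i j) -> is_scaling p A B ->
  log_scales (map_mx (@ln R) A) B.
Proof.
move=> A0 [d1 [d2 [d10 d20 BE B1 pB]]].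
have BijE i j : B i j = d1 0 i * A i j * d2 0 j.
  by rewrite BE mul_mx_diag mxE mul_diag_mx !mxE.
split; first by split=> // i j; rewrite BijE !mulr_gt0.
exists (\col_i ln (d1 0 i)), (map_mx (@ln R) d2).
apply/matrixP => i j; rewrite [RHS]mxE additive_mxE !mxE BijE.
by rewrite !lnM ?posrE ?mulr_gt0//; ring.
Qed.

Lemma sinkhornP A : (forall i j, 0 < A i j) ->
  log_scales (map_mx (@ln R) A) (sinkhorn p A).
Proof.
move=> A0; apply: is_scaling_log_scales => //.
have exB := scaling_exists p_gt0 weights_sum1 A0.
exact: (@xgetPex _ 0 [set B | is_scaling p A B] exB).
Qed.

(** The scaling as a function of the logarithm of the matrix. *)
Definition log_sinkhorn L : 'M[R]_n := sinkhorn p (map_mx (@expR R) L).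

Lemma log_sinkhornP L : log_scales L (log_sinkhorn L).
Proof.
have e0 i j : 0 < map_mx (@expR R) L i j by rewrite mxE expR_gt0.
have := sinkhornP e0; rewrite -map_mx_comp map_mx_id// => x.
exact: expRK.
Qed.

Lemma log_sinkhorn_manifold L : stoch_manifold p (log_sinkhorn L).
Proof. by have [] := log_sinkhornP L. Qed.

Lemma log_sinkhorn_eq L S : log_scales L S -> log_sinkhorn L = S.
Proof. exact/log_scales_unique/log_sinkhornP. Qed.

(** The contraction property in the sup norm, where the equivalence of norms costs a
    factor. *)
Lemma log_sinkhorn_lipschitz :
  exists2 k : R, 0 < k & forall L L',
    `|log_sinkhorn L' - log_sinkhorn L| <= k * `|L' - L|.
Proof.
(* The comparison of norms gives [n%:R / p i 0] for the squares of the entries of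
   row [i]; since [1 <= c], the square of [c] bounds this ratio. *)
pose c := 1 + \sum_i n%:R / p i 0.
have c1 : 1 <= c.
  by rewrite lerDl; apply: sumr_ge0 => i _; rewrite divr_ge0// ltW.
exists c; first exact: lt_le_trans c1.
move=> L L'; set D := log_sinkhorn _ - _.
have c0 : 0 <= c by exact: le_trans c1.
apply: mx_norm_le => [|i j]; first by rewrite mulr_ge0.
have := log_scales_contract (log_sinkhornP L) (log_sinkhornP L').
rewrite -/D; set m := `|L' - L|.
have m0 : 0 <= m by exact: normr_ge0.
have ub : weighted_dot (L' - L) (L' - L) <= n%:R * m ^+ 2.
  have <- : \sum_i p i 0 * (n%:R * m ^+ 2) = n%:R * m ^+ 2.
    by rewrite -mulr_suml weights_sum1 mul1r.
  apply: ler_sum => k _; rewrite -mulr_sumr ler_pM2l//.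
  rewrite (@le_trans _ _ (\sum_(l < n) m ^+ 2))//.
    apply: ler_sum => l _; rewrite -expr2 -real_normK ?num_real//.
    by rewrite lerXn2r ?nnegrE//; exact: coord_le_norm.
  by rewrite sumr_const card_ord mulr_natl.
have lb : p i 0 * (D i j) ^+ 2 <= weighted_dot D D.
  have ge0 k l : 0 <= p k 0 * (D k l * D k l).
    by apply: mulr_ge0; [exact: ltW|rewrite -expr2 sqr_ge0].
  rewrite /weighted_dot (bigD1 i)//= (bigD1 j)//= expr2 -addrA lerDl addr_ge0//.
    by apply: sumr_ge0 => l _.
  by apply: sumr_ge0 => k _; apply: sumr_ge0 => l _.
move=> mid; have {lb mid ub} := le_trans lb (le_trans mid ub).
rewrite mulrC -ler_pdivlMr// mulrAC => le.
rewrite -(@ler_pXn2r _ 2)// ?nnegrE ?mulr_ge0// real_normK ?num_real//.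
apply: le_trans le _; rewrite exprMn ler_wpM2r ?sqr_ge0//.
apply: (@le_trans _ _ c); last by rewrite expr2 ler_peMr.
rewrite /c (bigD1 i)//= addrCA lerDl addr_ge0// sumr_ge0// => k _.
by rewrite divr_ge0// ltW.
Qed.

End Scaling.

(** * The linearized scaling equation *)

Section Linearization.
Variables (R : realType) (n : nat) (p : 'cV[R]_n).
Hypothesis p_gt0 : forall i, 0 < p i 0.
Hypothesis p_sum1 : p^T *m ones = 1%:M.
Implicit Types L S X Y M : 'M[R]_n.

(** The weights cannot sum to 1 over an empty index set. *)
Lemma size_neq0 : n%:R != 0 :> R.
Proof.
rewrite pnatr_eq0; apply/eqP => n0.
have := weights_sum1 p_sum1; rewrite big1 => [/eqP|i].
  by rewrite eq_sym oner_eq0.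
by have := ltn_ord i; rewrite {2}n0.
Qed.

(** The projections on the vectors orthogonal to [p] and to the constants, acting
    respectively on the columns (from the left) and on the rows (from the right). *)
Definition left_proj : 'M[R]_n := 1%:M - ones *m p^T.
Definition right_proj : 'M[R]_n := 1%:M - n%:R^-1 *: (ones *m ones^T).

(** The projection on the tangent space along the additive matrices; it is orthogonal
    for [weighted_dot p]. *)
Definition tangent_proj M := left_proj *m M *m right_proj.

Lemma left_proj_ones : left_proj *m ones = 0.
Proof. by rewrite mulmxBl mul1mx -mulmxA p_sum1 mulmx1 subrr. Qed.

Lemma mul_weights_left_proj : p^T *m left_proj = 0.
Proof. by rewrite mulmxBr mulmx1 mulmxA p_sum1 mul1mx subrr. Qed.

Lemma tr_ones_mul_ones : (ones^T : 'rV[R]_n) *m ones = n%:R%:M.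
Proof.
apply/matrixP => i j; rewrite !ord1 !mxE (eq_bigr (fun=> 1)) => [|k _].
  by rewrite sumr_const card_ord.
by rewrite !mxE mulr1.
Qed.

Lemma tr_ones_right_proj : ones^T *m right_proj = 0.
Proof.
rewrite mulmxBr mulmx1 -scalemxAr mulmxA tr_ones_mul_ones mul_scalar_mx scalerA.
by rewrite mulVf ?size_neq0// scale1r subrr.
Qed.

Lemma right_proj_ones : right_proj *m ones = 0.
Proof.
rewrite mulmxBl mul1mx -scalemxAl -mulmxA tr_ones_mul_ones mul_mx_scalar scalerA.
by rewrite mulVf ?size_neq0// scale1r subrr.
Qed.

Lemma tangent_proj_tangent S M : stoch_tangent p S (tangent_proj M).
Proof.
split; first by rewrite /tangent_proj -mulmxA right_proj_ones mulmx0.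
by rewrite /tangent_proj !mulmxA mul_weights_left_proj !mul0mx.
Qed.

Lemma tangent_proj_id S X : stoch_tangent p S X -> tangent_proj X = X.
Proof.
move=> [X1 pX]; rewrite /tangent_proj mulmxBl mul1mx -mulmxA pX mulmx0 subr0.
by rewrite mulmxBr mulmx1 -scalemxAr mulmxA X1 mul0mx scaler0 subr0.
Qed.

Lemma tangent_proj_additive a b : tangent_proj (additive_mx a b) = 0.
Proof.
rewrite /tangent_proj /additive_mx mulmxDr mulmxDl.
rewrite [left_proj *m (ones *m b)]mulmxA left_proj_ones !mul0mx addr0.
by rewrite -!mulmxA tr_ones_right_proj !mulmx0.
Qed.

Fact tangent_proj_is_linear : linear tangent_proj.
Proof.
by move=> a M N; rewrite /tangent_proj linearP/= mulmxDl -scalemxAl.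
Qed.
HB.instance Definition _ :=
  GRing.isLinear.Build R 'M[R]_n 'M[R]_n _ tangent_proj tangent_proj_is_linear.

Lemma tangent_proj_additiveP M :
  exists a b, tangent_proj M = M + additive_mx a b.
Proof.
pose N := left_proj *m M.
exists (- (n%:R^-1 *: (N *m ones))), (- (p^T *m M)).
rewrite /tangent_proj -/N /right_proj /additive_mx mulmxBr mulmx1.
rewrite mulNmx mulmxN -scalemxAl -scalemxAr -!mulmxA addrA addrAC; congr (_ - _).
by rewrite /N /left_proj mulmxBl mul1mx mulmxA.
Qed.

(** The projection is self-adjoint. *)
Lemma tangent_dot_proj S X M : stoch_tangent p S X ->
  weighted_dot p X (tangent_proj M) = weighted_dot p X M.
Proof.
move=> TX; have [a [b ->]] := tangent_proj_additiveP M.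
by rewrite weighted_dotDr (tangent_additive_orthogonal _ _ TX) addr0.
Qed.

(** An extension to all matrices, injective for positive [S], of the linearized
    scaling equation.  If [X] is the derivative of the scaling [S] in the direction
    [M] of logarithms, then [X] is tangent and [hadamard_div X S - M] is additive,
    that is, [linearized S X = tangent_proj M].  The term [X - tangent_proj X], which
    vanishes on tangent vectors, makes the operator invertible on the whole matrix
    space. *)
Definition linearized S X :=
  X - tangent_proj X + tangent_proj (hadamard_div X S).

Fact linearized_is_linear S : linear (linearized S).
Proof.
move=> a X Y; rewrite /linearized.
have -> : hadamard_div (a *: X + Y) S = a *: hadamard_div X S + hadamard_div Y S.
  by apply/matrixP => i j; rewrite !mxE mulrDl mulrA.
rewrite !(linearP tangent_proj)/=.
move: (tangent_proj X) (tangent_proj Y) => PX PY.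
move: (tangent_proj _) (tangent_proj _) => QX QY.
by apply/matrixP => i j; rewrite !mxE; ring.
Qed.
HB.instance Definition _ S :=
  GRing.isLinear.Build R 'M[R]_n 'M[R]_n _ (linearized S)
    (linearized_is_linear S).

Lemma linearized_tangent S S0 X : stoch_tangent p S0 X ->
  linearized S X = tangent_proj (hadamard_div X S).
Proof. by move=> TX; rewrite /linearized (tangent_proj_id TX) subrr add0r. Qed.

(** Projecting [linearized S X = 0] shows that [X] is tangent and that the projection
    of [hadamard_div X S] is zero.  As the projection is self-adjoint, the inner
    product of [X] and [hadamard_div X S] is then zero too; it is a weighted sum of
    the squares of the entries of [X] divided by those of [S]. *)
Lemma linearized_inj0 S X : (forall i j, 0 < S i j) -> linearized S X = 0 -> X = 0.
Proof.
move=> S0 LX.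
have idem M : tangent_proj (tangent_proj M) = tangent_proj M.
  exact: tangent_proj_id (tangent_proj_tangent 0 M).
have PX : tangent_proj (hadamard_div X S) = 0.
  have := congr1 tangent_proj LX.
  by rewrite /linearized linearD linearB/= !idem subrr add0r linear0.
have TX : stoch_tangent p S X.
  have -> : X = tangent_proj X.
    by apply/subr0_eq; move: LX; rewrite /linearized PX addr0.
  exact: tangent_proj_tangent.
have XS i j : X i j * hadamard_div X S i j = X i j ^+ 2 / S i j.
  by rewrite mxE mulrA expr2.
have ge0 i j : 0 <= X i j * hadamard_div X S i j.
  by rewrite XS divr_ge0 ?sqr_ge0// ltW.
have : weighted_dot p X (hadamard_div X S) <= 0.
  rewrite -(tangent_dot_proj _ TX) PX /weighted_dot big1// => i _.
  by rewrite big1// => j _; rewrite mxE !mulr0.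
move=> /(weighted_dot_eq0 p_gt0 ge0) XX0; apply/matrixP => i j.
have /eqP := XX0 i j; rewrite XS mxE mulf_eq0 sqrf_eq0 invr_eq0.
by rewrite (gt_eqF (S0 i j)) orbF => /eqP.
Qed.

Lemma lin_mx_linearized_unit S : (forall i j, 0 < S i j) ->
  lin_mx (linearized S) \in unitmx.
Proof.
move=> S0; rewrite -row_free_unit; apply: inj_row_free => v.
rewrite -[v]vec_mxK mul_vec_lin => /eqP; rewrite mxvec_eq0 => /eqP.
by move=> /(linearized_inj0 S0) ->; rewrite linear0.
Qed.

(** The solution [X] of [linearized S X = tangent_proj M], by inverting the matrix of
    [linearized S] in the coordinates [mxvec]. *)
Definition log_sinkhorn_diff S M : 'M[R]_n :=
  vec_mx (mxvec (tangent_proj M) *m invmx (lin_mx (linearized S))).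

Fact log_sinkhorn_diff_is_linear S : linear (log_sinkhorn_diff S).
Proof.
move=> a M N.
by rewrite /log_sinkhorn_diff !linearP/= mulmxDl -scalemxAl linearP.
Qed.
HB.instance Definition _ S :=
  GRing.isLinear.Build R 'M[R]_n 'M[R]_n _ (log_sinkhorn_diff S)
    (log_sinkhorn_diff_is_linear S).

Lemma log_sinkhorn_diff_eq S X M : (forall i j, 0 < S i j) ->
  linearized S X = tangent_proj M -> log_sinkhorn_diff S M = X.
Proof.
move=> S0 eqX; rewrite /log_sinkhorn_diff -eqX -mul_vec_lin mulmxK ?mxvecK//.
exact: lin_mx_linearized_unit.
Qed.

End Linearization.

(** * Smoothness of the scaling *)

Section Smoothness.
Variables (R : realType) (n : nat) (p : 'cV[R]_n).
Hypothesis p_gt0 : forall i, 0 < p i 0.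
Hypothesis p_sum1 : p^T *m ones = 1%:M.
Implicit Types L S X Y M : 'M[R]_n.

Let log_sinkhorn_gt0 L i j : 0 < log_sinkhorn p L i j.
Proof. by have [_ _ ->] := log_sinkhorn_manifold p_gt0 p_sum1 L. Qed.

Lemma ln_taylor1 (s e : R) : 0 < s -> 0 < e ->
  \forall y \near (0 : R), `|ln (y + s) - (ln s + y / s)| <= e * `|y|.
Proof.
move=> s0 e0.
have lnd : differentiable (@ln R) s.
  by apply/derivable1_diffP; have := is_derive1_ln s0.
have /eqaddoP /(_ e e0) := diff_locally lnd.
apply: filterS => y /=; rewrite diff1E//.
have lnf := is_derive1_ln s0.
by rewrite derive1E derive_val.
Qed.

(** Let [Y] be the increment of the scaling for an increment [h] of the logarithm, and
    [r] the remainder of the first-order expansion of the entrywise logarithm at [S].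
    Then [Y] solves the linearized equation with right-hand side [h - r], so that it
    differs from the claimed differential at [h] by the differential at [r], and the
    Lipschitz bound on [Y] makes [r] negligible with respect to [h]. *)
Lemma log_sinkhorn_is_diff L :
  is_diff L (log_sinkhorn p) (log_sinkhorn_diff p (log_sinkhorn p L)).
Proof.
set S := log_sinkhorn p L.
have S0 i j : 0 < S i j := log_sinkhorn_gt0 L i j.
pose D : {linear 'M[R]_n -> 'M[R]_n} := log_sinkhorn_diff p S.
have Dc : continuous D by exact: linear_mx_continuous.
apply: (is_diff_epsP (df := D)) => // e e0.
have [k k0 Dk] := linear_lipschitz Dc.
have [K K0 SK] := log_sinkhorn_lipschitz p_gt0 p_sum1.
(* [k] bounds the differential and [K] the increment of the scaling. *)
have e'0 : 0 < e / (k * K) by rewrite divr_gt0// mulr_gt0.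
pose P i j := [set Y : 'M[R]_n |
    `|ln (Y i j + S i j) - (ln (S i j) + Y i j / S i j)| <= e / (k * K) * `|Y|].
have near_ln : nbhs (0 : 'M[R]_n) [set Y : 'M[R]_n | forall i j, P i j Y].
  suff Pn i j : nbhs (0 : 'M[R]_n) (P i j).
    pose Pn' i := @filter_forall _ _ (P i) _ (nbhs_filter (0 : 'M[R]_n)) (Pn i).
    exact: (@filter_forall _ _ (fun i => [set Y | forall j, P i j Y]) _
      (nbhs_filter (0 : 'M[R]_n)) Pn').
  have c0 : (fun Y : 'M[R]_n => Y i j) @ (0 : 'M[R]_n) --> (0 : R).
    by have := @coord_continuous R n n i j 0; rewrite /continuous_at mxE.
  have Q := c0 _ (ln_taylor1 (S0 i j) e'0).
  apply: (@filterS _ _ (nbhs_filter (0 : 'M[R]_n)) _ _ _ Q) => Y /le_trans; apply.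
  by rewrite ler_wpM2l ?(ltW e'0)// coord_le_norm.
have /nbhs_ballP[d d0 dln] := near_ln.
apply/nbhs_ballP; exists (d / K) => [|h hd]; first by rewrite /= divr_gt0.
set S' := log_sinkhorn p (h + L); pose Y := S' - S.
have Yh : `|Y| <= K * `|h| by rewrite /Y (le_trans (SK _ _))// addrK.
have {}hd : `|h| < d / K by move: hd; rewrite -ball_normE /= sub0r normrN.
have Yd : ball (0 : 'M[R]_n) d Y.
  rewrite -ball_normE /= sub0r normrN (le_lt_trans Yh)//.
  by rewrite mulrC -ltr_pdivlMr.
pose r := map_mx (@ln R) S' - map_mx (@ln R) S - hadamard_div Y S.
have rle : `|r| <= e / (k * K) * `|Y|.
  apply: mx_norm_le => [|i j]; first by rewrite mulr_ge0 ?(ltW e'0).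
  have YS : Y i j + S i j = S' i j by rewrite /Y mxE [X in _ + X + _]mxE subrK.
  have := dln _ Yd i j; rewrite /P /= YS opprD addrA.
  by rewrite /r !mxE.
have DY : D (h - r) = Y.
  apply: log_sinkhorn_diff_eq => //.
  have [mS [a [b lnS]]] := log_sinkhornP p_gt0 p_sum1 L.
  have [mS' [a' [b' lnS']]] := log_sinkhornP p_gt0 p_sum1 (h + L).
  rewrite (linearized_tangent _ (stoch_manifold_sub mS mS')).
  have -> : h - r = hadamard_div Y S + additive_mx (a - a') (b - b').
    rewrite /r lnS lnS' -additive_mxD -additive_mxN.
    move: (hadamard_div Y S) (additive_mx _ _) (additive_mx _ _) => Q B B'.
    by apply/matrixP => i j; rewrite !mxE; ring.
  by rewrite (linearD (tangent_proj p)) /= tangent_proj_additive// addr0.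
rewrite (_ : _ - _ = - D r); last first.
  have -> : S' = D h - D r + S by rewrite -linearB DY subrK.
  by rewrite opprD addrA addrK addrAC subrr sub0r.
rewrite normrN (le_trans (Dk _))// mulrC -ler_pdivlMr// (le_trans rle)//.
rewrite (le_trans (ler_wpM2l (ltW e'0) Yh))//.
have k_neq0 := lt0r_neq0 k0; have K_neq0 := lt0r_neq0 K0.
rewrite le_eqVlt; apply/orP; left; apply/eqP; field.
by rewrite k_neq0.
Qed.

Lemma Ck_linearized (V : normedModType R) (U : set V) k (S : V -> 'M[R]_n) X :
  open U -> (forall x, U x -> forall i j, 0 < S x i j) -> Ck k U S ->
  Ck k U (fun x => linearized p (S x) X).
Proof.
move=> oU S0 Sk; apply: CkD => //; first exact: (Ck_cst oU).
apply: (Ck_linear oU (g := tangent_proj p)); first exact: linear_mx_continuous.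
apply: (Ck_mx oU) => i j.
apply: (Ck_ext oU (f := fun x => X i j * (S x i j)^-1)) => [x _|].
  by rewrite mxE.
apply: (CkM oU); first exact: (Ck_cst oU).
apply: (CkV oU); last exact: (Ck_coord oU).
by move=> x Ux; rewrite gt_eqF// S0.
Qed.

Lemma Ck_lin_mx_linearized (V : normedModType R) (U : set V) k (S : V -> 'M[R]_n) :
  open U -> (forall x, U x -> forall i j, 0 < S x i j) -> Ck k U S ->
  Ck k U (fun x => lin_mx (linearized p (S x))).
Proof.
move=> oU S0 Sk; apply: (Ck_mx oU) => i j.
pose X : 'M[R]_n := vec_mx (delta_mx 0 i).
apply: (Ck_ext oU (f := fun x => mxvec (linearized p (S x) X) 0 j)) => [x _|].
  by rewrite mxE.
apply: (Ck_coord oU); apply: (Ck_linear oU (g := mxvec)).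
  exact: linear_mx_continuous.
exact: Ck_linearized.
Qed.

(** Bootstrap: the differential is a rational expression in the scaling itself and in
    the differential of [L], so each derivative of [L] gives one more of the scaling. *)
Lemma Ck_log_sinkhorn (V : normedModType R) (U : set V) k (L : V -> 'M[R]_n) :
  open U -> Ck k U L -> Ck k U (fun x => log_sinkhorn p (L x)).
Proof.
move=> oU; elim: k => [|k IHk] Lk.
  move=> x Ux; apply: continuous_comp; first exact: Lk.
  have := log_sinkhorn_is_diff (L x) => dL.
  exact: differentiable_continuous.
apply: (CkS oU (df := fun x v =>
    log_sinkhorn_diff p (log_sinkhorn p (L x)) ('d L x v))) => [x Ux|v].
  have dL := CkS_is_diff Lk Ux; have dS := log_sinkhorn_is_diff (L x).
  exact: is_diff_comp.
have Sk : Ck k U (fun x => log_sinkhorn p (L x)) by apply: IHk; exact: CkW.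
apply: (Ck_linear oU (g := vec_mx)); first exact: linear_mx_continuous.
apply: (Ck_mulmx oU); last first.
  apply: (Ck_invmx oU); last exact: Ck_lin_mx_linearized.
  by move=> x _; exact: lin_mx_linearized_unit.
apply: (Ck_linear oU (g := mxvec)); first exact: linear_mx_continuous.
apply: (Ck_linear oU (g := tangent_proj p)); first exact: linear_mx_continuous.
by have [_] := Lk; apply.
Qed.

End Smoothness.

(** * The retraction *)

Section Retraction.
Variables (R : realType) (n : nat) (p : 'cV[R]_n).
Hypothesis p_gt0 : forall i, 0 < p i 0.
Hypothesis p_sum1 : p^T *m ones = 1%:M.
Implicit Types S X : 'M[R]_n.

Local Notation VV := ('M[R]_n * 'M[R]_n)%type.

(** The logarithm of the matrix that the retraction scales, as a function of the base
    point [q.1] and the tangent vector [q.2]. *)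
Definition log_argument (q : VV) : 'M[R]_n :=
  map_mx (@ln R) q.1 + hadamard_div q.2 q.1.

Lemma sinkhorn_retractionE (q : VV) : (forall i j, 0 < q.1 i j) ->
  sinkhorn_retraction p q = log_sinkhorn p (log_argument q).
Proof.
move=> q0; rewrite /sinkhorn_retraction /log_sinkhorn; congr sinkhorn.
by apply/matrixP => i j; rewrite !mxE expRD lnK ?posrE.
Qed.

Lemma log_scales_ln S : stoch_manifold p S -> log_scales p (map_mx (@ln R) S) S.
Proof.
move=> mS; split=> //; exists 0, 0.
by rewrite /additive_mx mul0mx mulmx0 !addr0.
Qed.

Lemma log_sinkhorn_ln S : stoch_manifold p S ->
  log_sinkhorn p (map_mx (@ln R) S) = S.
Proof. by move=> /log_scales_ln; exact: log_sinkhorn_eq. Qed.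

(** The open set of pairs with positive base point, on which the retraction extends
    smoothly. *)
Definition positive_base : set VV := [set q : VV | forall i j, 0 < q.1 i j].

Lemma open_positive_base : open positive_base.
Proof.
rewrite openE => q q0.
suff qn i j : nbhs q [set q' : VV | 0 < q'.1 i j].
  pose qn' i := @filter_forall _ _ (fun j => [set q' : VV | 0 < q'.1 i j]) _
    (nbhs_filter q) (qn i).
  exact: (@filter_forall _ _ (fun i => [set q' : VV | forall j, 0 < q'.1 i j]) _
      (nbhs_filter q) qn').
have c : {for q, continuous (fun q' : VV => q'.1 i j)}.
  exact: (continuous_comp (@cvg_fst _ _ _ _ _) (@coord_continuous R n n i j q.1)).
exact: (c _ (lt_nbhsr (q0 i j))).
Qed.

Lemma smooth_log_argument k : Ck k positive_base log_argument.
Proof.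
have oU := open_positive_base.
have lin1 : linear (fun q : VV => q.1) by [].
have lin2 : linear (fun q : VV => q.2) by [].
pose pr1 : {linear VV -> 'M[R]_n} :=
  HB.pack (fun q : VV => q.1) (GRing.isLinear.Build _ _ _ _ _ lin1).
pose pr2 : {linear VV -> 'M[R]_n} :=
  HB.pack (fun q : VV => q.2) (GRing.isLinear.Build _ _ _ _ _ lin2).
have Ck1 i j : Ck k positive_base (fun q : VV => q.1 i j).
  apply: (Ck_coord oU); apply: (Ck_linear oU (g := pr1) (f := id)).
    by move=> q; exact: cvg_fst.
  exact: Ck_id.
have Ck2 i j : Ck k positive_base (fun q : VV => q.2 i j).
  apply: (Ck_coord oU); apply: (Ck_linear oU (g := pr2) (f := id)).
    by move=> q; exact: cvg_snd.
  exact: Ck_id.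
apply: (Ck_mx oU) => i j.
apply: (Ck_ext oU (f := fun q : VV => ln (q.1 i j) + q.2 i j * (q.1 i j)^-1)).
  by move=> q _; rewrite !mxE.
apply: (CkD oU); first by apply: (Ck_ln oU) => // q; exact.
apply: (CkM oU) => //; apply: (CkV oU) => // q q0.
by rewrite gt_eqF// q0.
Qed.

Lemma sinkhorn_retraction_rigid S xi :
  stoch_manifold p S -> stoch_tangent p S xi ->
  is_derive (0 : R) 1 (fun t : R => sinkhorn_retraction p (S, t *: xi)) xi.
Proof.
move=> mS Txi; have [_ _ S0] := mS.
pose N := hadamard_div xi S.
pose g (t : R) := map_mx (@ln R) S + t *: N.
have -> : (fun t : R => sinkhorn_retraction p (S, t *: xi)) = log_sinkhorn p \o g.
  apply/funext => t; rewrite sinkhorn_retractionE; last by move=> i j; exact: S0.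
  rewrite /= /g; congr (log_sinkhorn p _).
  by apply/matrixP => i j; rewrite !mxE mulrA.
have dg : is_diff (0 : R) g (fun t : R => t *: N).
  have d1 := is_diff_cst (map_mx (@ln R) S) (0 : R).
  have d2 := is_diff_scalel (0 : R) N.
  apply: is_diff_eq (is_diffD d1 d2) _.
  by rewrite add0r.
have g0 : g 0 = map_mx (@ln R) S by rewrite /g scale0r addr0.
have dS := log_sinkhorn_is_diff p_gt0 p_sum1 (g 0).
have dSg : is_diff (0 : R) (log_sinkhorn p \o g) _ := is_diff_comp dg dS.
apply: DeriveDef; first exact: diff_derivable.
rewrite deriveE// diff_val /= scale1r g0 log_sinkhorn_ln//.
apply: log_sinkhorn_diff_eq => //.
(* For tangent [xi] the linearized equation in the direction [hadamard_div xi S] has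
   the solution [xi]. *)
exact: linearized_tangent Txi.
Qed.

End Retraction.

Unset Implicit Arguments.

Theorem theorem4p10 (R : realType) (n : nat) (p : 'cV[R]_n)
    (p_gt0 : forall i, 0 < p i 0)
    (p_sum1 : p^T *m ones = 1%:M) :
  first_order_retraction (stoch_manifold p) (stoch_tangent p)
    (sinkhorn_retraction p).
Proof.
split.
- move=> q [[_ _ q0] _]; rewrite sinkhorn_retractionE//.
  exact: log_sinkhorn_manifold.
- move=> q [[_ _ q0] _].
  exists (positive_base (n := n)), (fun q => log_sinkhorn p (log_argument q)).
  split=> //; first exact: open_positive_base.
    move=> k; apply: Ck_log_sinkhorn => //; first exact: open_positive_base.
    exact: smooth_log_argument.
  by move=> q' _ q'0; rewrite sinkhorn_retractionE.
- move=> S mS; have [_ _ S0] := mS; rewrite sinkhorn_retractionE//.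
  rewrite (_ : log_argument (S, 0) = map_mx (@ln R) S) ?log_sinkhorn_ln//.
  by apply/matrixP => i j; rewrite !mxE mul0r addr0.
- by move=> S xi mS Txi; exact: sinkhorn_retraction_rigid.
Qed.
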